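(* Let $d\ge 1$ be an integer and let $\mathbb{T}_d$ be the tree in which every vertex has degree $d+1$, with a distinguished vertex $\mathcal{O}$ (the origin). Consider the cone percolation process on $\mathbb{T}_d$ with radius of influence $R$, and let $I$ be the set of vertices reached by it. If $\mathbb{E}(d^R) < 2-\frac{1}{d}$, then $$\frac{d+\mathbb{E}(d^R)-p_0}{d\,[1-\mathbb{E}(d^R)+p_0]}\ \le\ \mathbb{E}(|I|)\ \le\ \frac{\mathbb{E}(d^R)+d-2}{2d-1-d\,\mathbb{E}(d^R)}.$$
   Context: Cone percolation process: Let $\mathbb{T}$ be a tree with origin $\mathcal{O}$ and graph distance $d(\cdot,\cdot)$. Write $u\le v$ if $u$ lies on the path from $\mathcal{O}$ to $v$. Let $R$ be a random variable with values in $\{0,1,2,\dots\}$, $p_k=\mathbb{P}(R=k)$, and assume $p_0\in(0,1)$. Let $\{R_v\}_{v}$ be i.i.d. copies of $R$ indexed by the vertices. For each vertex $u$ let $B_u=\{v: u\le v,\ d(u,v)\le R_u\}$. Set $I_0=\{\mathcal{O}\}$, $I_{n+1}=\bigcup_{u\in I_n}B_u$ for $n\ge 0$, and $I=\bigcup_{n\ge0}I_n$. *)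

(* Defs.v *)
From HB Require Import structures.
From mathcomp Require Import all_boot all_order all_algebra.
From mathcomp Require Import all_classical all_reals all_analysis.
Set Implicit Arguments. Unset Strict Implicit. Unset Printing Implicit Defensive.
Import Order.TTheory GRing.Theory Num.Theory.
Local Open Scope classical_set_scope.
Local Open Scope ring_scope.

(* Vertices of the (d+1)-regular tree T_d, rooted at the origin O = [::].
   A vertex is the list of child indices read from the root: the root has
   d+1 children (indices < d+1), every other vertex has d children
   (indices < d), so every vertex has degree d+1.
   u <= v (u on the path from O to v) iff u is a prefix of v, and then
   the graph distance is d(u,v) = size v - size u. *)
Definition tree_vertex (d : nat) (v : seq nat) : bool :=
  match v with
  | [::] => true
  | c :: w => (c < d.+1)%N && all (fun x => (x < d)%N) w
  end.

Definition below (u v : seq nat) : bool := prefix u v.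

Definition tdist (u v : seq nat) : nat := (size v - size u)%N.

Section Cone.
Variables (d : nat) (Omega : Type) (Rad : seq nat -> Omega -> nat).

Definition cone_ball (u : seq nat) (w : Omega) : set (seq nat) :=
  [set v | tree_vertex d v /\ below u v /\ (tdist u v <= Rad u w)%N].

Fixpoint cone_step (n : nat) (w : Omega) : set (seq nat) :=
  match n with
  | 0 => [set [::]]
  | n'.+1 => \bigcup_(u in cone_step n' w) cone_ball u w
  end.

Definition cone_reached (w : Omega) : set (seq nat) :=
  \bigcup_(n in [set: nat]) cone_step n w.
End Cone.

(* |I| as an extended real (+oo if I is infinite) *)
Definition ecard {R : realType} (A : set (seq nat)) : \bar R :=
  (\esum_(v in A) (1 : \bar R))%E.

(* Main.v *)
Require Import Defs.
From HB Require Import structures.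
From mathcomp Require Import all_boot all_order all_algebra.
From mathcomp Require Import all_classical all_reals all_analysis.
From mathcomp Require Import measurable_realfun zify ring lra.
Set Implicit Arguments. Unset Strict Implicit. Unset Printing Implicit Defensive.
Import Order.TTheory GRing.Theory Num.Theory.
Local Open Scope classical_set_scope.
Local Open Scope ring_scope.

(** Along the path from the root to a vertex of depth [n], let [a n] be the
    probability that the vertex is reached. A reached vertex other than the root
    lies in the ball of a strict ancestor that is itself reached, and being
    reached is independent of a vertex's own radius; hence [a n] is at most the
    solution of the renewal equation with weights [P(R >= k)]. Conversely, the
    walk that jumps from its current position [i] of the path exactly [R_i] steps
    further only visits reached vertices, and it hits [n] with probability the
    solution of the renewal equation with weights [P(R = k)]. Weighting by the
    [(d + 1) * d ^ (n - 1)] vertices of depth [n] and summing the two renewal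
    equations gives the two bounds. *)

(** * Renewal equations *)

Section Renewal.
Variables (R : realType) (g : nat -> R).

(** The renewal equation is a course-of-values recursion; carrying the list of all earlier values
    makes it structural. *)
Fixpoint renewal_list (n : nat) : seq R :=
  if n is n'.+1 then
    let s := renewal_list n' in
    rcons s (\sum_(i < size s) s`_i * g (size s - i))
  else [:: 1].

Definition renewal (n : nat) : R := (renewal_list n)`_n.

Lemma size_renewal_list n : size (renewal_list n) = n.+1.
Proof. by elim: n => //= n IH; rewrite size_rcons IH. Qed.

Lemma nth_renewal_list n i : (i <= n)%N -> (renewal_list n)`_i = renewal i.
Proof.
elim: n => [|n IH]; first by rewrite leqn0 => /eqP ->.
rewrite leq_eqVlt => /predU1P[-> //|]; rewrite ltnS => le_in.
by rewrite /= nth_rcons size_renewal_list ltnS le_in IH.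
Qed.

Lemma renewal0 : renewal 0 = 1. Proof. by []. Qed.

Lemma renewalS n :
  renewal n.+1 = \sum_(i < n.+1) renewal i * g (n.+1 - i).
Proof.
rewrite /renewal /= nth_rcons size_renewal_list ltnn eqxx.
by apply: eq_bigr => i _; rewrite nth_renewal_list // -ltnS.
Qed.

Hypothesis g_ge0 : forall n, 0 <= g n.

Lemma renewal_ge0 n : 0 <= renewal n.
Proof.
elim/ltn_ind: n => -[_|n IH]; first by rewrite renewal0.
by rewrite renewalS; apply: sumr_ge0 => i _; rewrite mulr_ge0 ?IH.
Qed.

(** Expand every term of positive index by the recursion and exchange the two sums: index [i]
    contributes once for each jump length that stays within [N]. *)
Lemma renewal_sumE N :
  \sum_(n < N.+1) renewal n =
  1 + \sum_(i < N) renewal i * \sum_(k < N - i) g k.+1.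
Proof.
rewrite big_ord_recl renewal0; congr (_ + _).
elim: N => [|N IH]; first by rewrite !big_ord0.
rewrite big_ord_recr IH /= /bump /= add1n renewalS big_ord_recr.
rewrite [in RHS]big_ord_recr /= subSnn big_ord_recl big_ord0 addr0 addrA.
rewrite -big_split /=; congr (_ + _).
apply: eq_bigr => i _; rewrite -mulrDr subSn 1?ltnW //.
by rewrite big_ord_recr.
Qed.

Lemma renewal_sum_le N :
  \sum_(n < N.+1) renewal n <=
  1 + (\sum_(n < N.+1) renewal n) * \sum_(k < N) g k.+1.
Proof.
rewrite {1}renewal_sumE lerD2l mulr_suml big_ord_recr /= -[leLHS]addr0.
apply: lerD; last by rewrite mulr_ge0 ?renewal_ge0 ?sumr_ge0.
apply: ler_sum => i _; rewrite ler_wpM2l ?renewal_ge0 //.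
rewrite -!(big_mkord xpredT (fun k => g k.+1)).
rewrite [leRHS](@big_cat_nat _ _ _ (N - i)%N) ?leq_subr //= lerDl.
by rewrite sumr_ge0.
Qed.

(** For [i < N] the window of length [N + K - i] contains the first [K] weights; the terms with
    [i >= N] are nonnegative and dropped. *)
Lemma renewal_sum_ge N K :
  1 + (\sum_(n < N) renewal n) * \sum_(k < K) g k.+1 <=
  \sum_(n < (N + K).+1) renewal n.
Proof.
rewrite renewal_sumE lerD2l mulr_suml.
rewrite -!(big_mkord xpredT (fun i => renewal i * _)).
rewrite -(big_mkord xpredT (fun i => renewal i * \sum_(k < N + K - i) g k.+1)).
rewrite [leRHS](@big_cat_nat _ _ _ N) ?leq_addr //= -[leLHS]addr0.
apply: lerD; last first.
  by rewrite sumr_ge0 // => i _; rewrite mulr_ge0 ?renewal_ge0 ?sumr_ge0.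
rewrite big_nat_cond [leRHS]big_nat_cond.
apply: ler_sum => i /andP[/andP[_ lt_iN] _]; rewrite ler_wpM2l ?renewal_ge0 //.
rewrite -!(big_mkord xpredT (fun k => g k.+1)).
rewrite [leRHS](@big_cat_nat _ _ _ K) //=; last by lia.
by rewrite lerDl sumr_ge0.
Qed.

Lemma renewal_sum_bounded N q :
  \sum_(k < N) g k.+1 <= q -> q < 1 ->
  \sum_(n < N.+1) renewal n <= (1 - q)^-1.
Proof.
move=> le_q q1; have := renewal_sum_le N; set X := \sum_(n < N.+1) _ => X_le.
have X0 : 0 <= X by rewrite sumr_ge0 // => i _; exact: renewal_ge0.
rewrite -[leRHS]mul1r ler_pdivlMr ?subr_gt0 //.
by have := ler_wpM2l X0 le_q; lra.
Qed.

(* The supremum [S] of the partial sums satisfies [1 + S * sum g <= S]. *)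
Lemma renewal_sum_bound_ge K c :
  (forall N, \sum_(n < N) renewal n <= c) ->
  1 <= c * (1 - \sum_(k < K) g k.+1).
Proof.
move=> Xc; set M := \sum_(k < K) _.
have M0 : 0 <= M by rewrite sumr_ge0.
pose X N := \sum_(n < N) renewal n.
have supX : has_sup (range X).
  by split; [exists (X 0%N), 0%N | exists c => _ [N _ <-]; exact: Xc].
have leS N : X N <= sup (range X) by apply: ub_le_sup; [case: supX | exists N].
have Sc : sup (range X) <= c.
  by apply: ge_sup; [case: supX | move=> _ [N _ <-]; exact: Xc].
have XS N : 1 + X N * M <= sup (range X).
  exact: le_trans (renewal_sum_ge N K) (leS _).
have S1 : 1 <= sup (range X).
  by have := XS 0%N; rewrite /X big_ord0; lra.
have SM : 1 + sup (range X) * M <= sup (range X).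
  have [->|Mn0] := eqVneq M 0; first by lra.
  have Mp : 0 < M by rewrite lt0r Mn0.
  rewrite -lerBrDl -ler_pdivlMr //; apply: ge_sup; first by case: supX.
  by move=> _ [N _ <-]; rewrite ler_pdivlMr // lerBrDl.
(* By [SM] the product of the supremum with [1 - M] is at least 1, and the supremum is positive by
   [S1]. *)
have M1 : 0 <= 1 - M by nra.
by have := ler_wpM2r M1 Sc; lra.
Qed.

End Renewal.

(** Since [x ^+ i * x ^+ (n - i) = x ^+ n], the factor passes through the convolution. This absorbs
    the growth of the levels into the weights. *)
Lemma renewal_scale (R : realType) (g : nat -> R) (x : R) n :
  renewal (fun k => x ^+ k * g k) n = x ^+ n * renewal g n.
Proof.
elim/ltn_ind: n => -[_|n IH]; first by rewrite !renewal0 expr0 mul1r.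
rewrite !renewalS mulr_sumr; apply: eq_bigr => i _.
rewrite IH // mulrACA -exprD subnKC //; exact: ltnW.
Qed.

(** * Events determined by finitely many radii *)

(** This stands for membership in the sigma-algebra of the first [n] variables. Since these take
    countably many values, measurability follows from it. *)
Definition determined (T : Type) (X : nat -> T -> nat) (n : nat) (E : set T) :=
  forall w w', (forall i, (i < n)%N -> X i w = X i w') -> E w -> E w'.

Lemma measurable_geq_fun (dm : measure_display) (T : measurableType dm)
    (f : T -> nat) (k : nat) :
  (forall i, measurable [set w | f w = i]) ->
  measurable [set w | (k <= f w)%N].
Proof.
move=> mf; rewrite (_ : [set _ | _] =
    \bigcup_(i in [set i | (k <= i)%N]) [set w | f w = i]).
  exact: bigcup_measurable.
by apply/seteqP; split=> [w /= le|w [i /= le ->]] //; exists (f w).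
Qed.

Section Determined.
Variables (T : Type) (X : nat -> T -> nat).

(** Saturating under agreement on the first [n] variables forgets variable [n], so that the slice is
    determined by the earlier ones. *)
Definition slice (n j : nat) (E : set T) : set T :=
  [set w' | exists w, [/\ E w, X n w = j & forall i, (i < n)%N -> X i w = X i w']].

Lemma determined_slice n j E : determined X n (slice n j E).
Proof.
move=> w w' ww' [w0 [E0 X0 H0]]; exists w0; split=> // i lt_in.
by rewrite H0 // ww'.
Qed.

Lemma sliceE n E : determined X n.+1 E ->
  E = \bigcup_j (slice n j E `&` [set w | X n w = j]).
Proof.
move=> detE; apply/seteqP; split=> [w Ew|w' [j _ [[w [Ew Xj agree]] /= Xj']]].
  by exists (X n w) => //; split => //; exists w; split.
apply: detE Ew => i; rewrite ltnS leq_eqVlt => /predU1P[->|/agree //].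
by rewrite Xj Xj'.
Qed.

Lemma determined0 E : determined X 0 E -> E = set0 \/ E = setT.
Proof.
move=> detE; have [->|/set0P[w Ew]] := eqVneq E set0; [by left | right].
by apply/seteqP; split=> // w' _; exact: detE Ew.
Qed.

End Determined.

Section Independence.
Variables (R : realType) (dm : measure_display) (Omega : measurableType dm).
Variables (P : probability Omega R) (X : nat -> Omega -> nat) (p : nat -> R).
Variable N : nat.
Hypothesis X_meas : forall n k, measurable [set w | X n w = k].
Hypothesis X_iid : forall (S : seq nat) (k : nat -> nat),
  uniq S -> all (fun i => (i <= N)%N) S ->
  P (\bigcap_(i in [set` S]) [set w | X i w = k i]) =
    (\prod_(i <- S) p (k i))%:E.

Lemma determined_measurable n E : determined X n E -> measurable E.
Proof.
elim: n E => [|n IH] E detE.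
  by have [->|->] := determined0 detE; [exact: measurable0 | exact: measurableT].
rewrite (sliceE detE); apply: bigcup_measurable => j _.
by apply: measurableI => //; apply: IH; exact: determined_slice.
Qed.

Let cyl (S : seq nat) (k : nat -> nat) : set Omega :=
  \bigcap_(i in [set` S]) [set w | X i w = k i].

Let cyl_measurable S k : measurable (cyl S k).
Proof.
rewrite /cyl bigcap_seq; apply: bigsetI_measurable => i _; exact: X_meas.
Qed.

(** Induction on [n]: split [E] by the value [j] of variable [n], move the condition [X n w = j]
    into the cylinder, and sum over [j]. A general [S] is required because the cylinder grows along
    the induction. *)
Lemma determined_indep_cyl n E (S : seq nat) (k : nat -> nat) :
  determined X n E -> uniq S ->
  all (fun i => (n <= i <= N)%N) S -> (n <= N.+1)%N ->
  P (E `&` cyl S k) = (P E * (\prod_(i <- S) p (k i))%:E)%E.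
Proof.
elim: n E S k => [|n IH] E S k detE uniqS allS le_nN.
  have [->|->] := determined0 detE; first by rewrite set0I measure0 mul0e.
  by rewrite setTI probability_setT mul1e X_iid.
have mslice j : measurable (slice X n j E `&` [set w | X n w = j]).
  apply: measurableI => //.
  exact: determined_measurable (@determined_slice _ X n j E).
have triv (C : set Omega) :
    trivIset setT (fun j => slice X n j E `&` [set w | X n w = j] `&` C).
  move=> i j _ _ [w [[[_ /= Xi] _] [[_ /= Xj] _]]].
  by rewrite -Xi -Xj.
have nS : n \notin S.
  by apply/negP => /(allP allS); rewrite ltnn.
have allnS : all (fun i => (n <= i <= N)%N) S.
  by apply: sub_all allS => i /andP[/ltnW -> ->].
have Pj j : P (slice X n j E `&` [set w | X n w = j]) =
    (P (slice X n j E) * (p j)%:E)%E.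
  have := @IH _ [:: n] (fun=> j) (@determined_slice _ X n j E) isT.
  rewrite /cyl bigcap_seq !big_seq1 /= leqnn /= andbT -ltnS; apply => //.
  exact: ltnW.
have PjC j : P (slice X n j E `&` [set w | X n w = j] `&` cyl S k) =
    (P (slice X n j E) * (p j)%:E * (\prod_(i <- S) p (k i))%:E)%E.
  (* As [n] is not in [S], prescribing [j] at [n] leaves the conditions on [S] unchanged. *)
  pose k' i := if i == n then j else k i.
  have := @IH _ (n :: S) k' (@determined_slice _ X n j E).
  rewrite /= nS uniqS leqnn -ltnS le_nN allnS (ltnW le_nN) => /(_ isT isT isT).
  rewrite big_cons /k' eqxx EFinM muleA.
  rewrite [in X in _ = X -> _](eq_big_seq (fun i => p (k i))); last first.
    by move=> i iS /=; case: eqP => // in'; rewrite -in' iS in nS.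
  move=> <-; congr (P _); rewrite -setIA; congr (_ `&` _).
  rewrite /cyl !bigcap_seq big_cons eqxx; congr (_ `&` _).
  apply: eq_big_seq => i iS /=; case: eqP => // in'.
  by rewrite -in' iS in nS.
rewrite {1}(sliceE detE) setI_bigcupl measure_bigcup //; last first.
  by move=> j _; exact: measurableI.
rewrite [in RHS](sliceE detE) measure_bigcup //; last first.
  by move=> i j _ _ [w [[_ /= Xi] [_ /= Xj]]]; rewrite -Xi -Xj.
have prod_ge0 : (0 <= (\prod_(i <- S) p (k i))%:E)%E.
  by rewrite -X_iid //; apply: sub_all allnS => i /andP[].
rewrite muleC -nneseriesZl //.
apply: eq_eseriesr => j _.
apply: (etrans (PjC j)); rewrite muleC; congr (_ * _)%E.
exact/esym/Pj.
Qed.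

Lemma determined_indep n E k : determined X n E -> (n <= N)%N ->
  P (E `&` [set w | X n w = k]) = (P E * (p k)%:E)%E.
Proof.
move=> detE le_nN.
have := @determined_indep_cyl n E [:: n] (fun=> k) detE isT.
by rewrite /cyl bigcap_seq !big_seq1 /= leqnn le_nN; apply=> //; exact: leqW.
Qed.

(** Induction on [k], removing the layer [X n w = k] at each step; writing the tail as a finite
    complement avoids a series. *)
Lemma determined_indep_ge n E k : determined X n E -> (n <= N)%N ->
  P (E `&` [set w | (k <= X n w)%N]) = (P E * (1 - \sum_(j < k) p j)%:E)%E.
Proof.
move=> detE le_nN; have mE := determined_measurable detE.
have fE : P E \is a fin_num by rewrite fin_num_measure.
elim: k => [|k IH].
  by rewrite big_ord0 subr0 mule1; congr (P _); apply/seteqP; split=> w // [].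
have mge j : measurable [set w | (j <= X n w)%N] by exact: measurable_geq_fun.
have mE1 : measurable (E `&` [set w | (k <= X n w)%N]) by exact: measurableI.
have mE2 : measurable (E `&` [set w | X n w = k]) by exact: measurableI.
have E1oo : (P (E `&` [set w | (k <= X n w)%N]) < +oo)%E.
  by rewrite ltey_eq fin_num_measure.
have -> : E `&` [set w | (k.+1 <= X n w)%N] =
    (E `&` [set w | (k <= X n w)%N]) `\` (E `&` [set w | X n w = k]).
  apply/seteqP; split=> w /=.
    by move=> [Ew lt_k]; split; [split=> //; exact: ltnW | move=> [_ eqk]; rewrite eqk ltnn in lt_k].
  move=> [[Ew]]; rewrite leq_eqVlt => /predU1P[<- H|//].
  by exfalso; apply: H.
apply: (etrans (measureD mE1 mE2 E1oo)).
rewrite (@setIidr _ _ (E `&` [set w | X n w = k])); last by move=> w [Ew /= ->]; split => /=.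
apply: (etrans (congr2 (fun x y => x - y)%E IH (determined_indep k detE le_nN))).
rewrite -muleBr //.
by rewrite -EFinB big_ord_recr /= opprD addrA.
Qed.

End Independence.

(** * Jumps along a path, the tree and the reached set *)

Section Jumps.
Implicit Types r : nat -> nat.

Definition jump_pos r k := iter k (fun i => i + r i)%N 0%N.

Definition hit r n := exists k, jump_pos r k = n.

Lemma jump_pos_homo r : {homo jump_pos r : k l / (k <= l)%N}.
Proof.
by apply: homo_leq => // [l k m|k /=]; [exact: leq_trans | exact: leq_addr].
Qed.

Lemma hit0 r : hit r 0. Proof. by exists 0%N. Qed.

Lemma hit_jump r i : hit r i -> hit r (i + r i).
Proof. by move=> [k <-]; exists k.+1. Qed.

(** Jumps of length zero do not move the walk, so going back in time past them yields the jump that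
    arrived at [n]. *)
Lemma hitP r n : (0 < n)%N -> hit r n ->
  exists i, [/\ (i < n)%N, hit r i & r i = (n - i)%N].
Proof.
move=> n0 [k]; elim: k => [n_eq|k IH eqn]; first by rewrite -n_eq in n0.
have [r0|r0] := posnP (r (jump_pos r k)).
  by apply: IH; rewrite -eqn /= -/(jump_pos r k) r0 addn0.
exists (jump_pos r k); rewrite -eqn /= -/(jump_pos r k).
by split; [rewrite -[ltnLHS]addn0 ltn_add2l | exists k | rewrite addKn].
Qed.

Lemma hit_agree r r' n : (forall i, (i < n)%N -> r i = r' i) ->
  hit r n -> hit r' n.
Proof.
elim/ltn_ind: n => n IH agree; have [-> _|n0] := posnP n; first exact: hit0.
move=> /(hitP n0)[i [lt_in hit_i ri]].
rewrite -(subnKC (ltnW lt_in)) -ri agree //; apply: hit_jump.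
by apply: IH => // j lt_ji; apply: agree; exact: ltn_trans lt_in.
Qed.

(** The walk never moves back: if [i < j] were both visited and [i] jumped to [n], then [j] would be
    visited after the walk is already at [n > j]. *)
Lemma hit_pred_uniq r n i j : (i < n)%N -> (j < n)%N ->
  hit r i -> r i = (n - i)%N -> hit r j -> r j = (n - j)%N -> i = j.
Proof.
wlog lt_ij : i j / (i < j)%N.
  move=> H *; have [lt|lt|//] := ltngtP i j; first exact: H.
  by apply/esym/H.
move=> lt_in lt_jn [k posk] ri [l posl] rj.
have lt_kl : (k < l)%N.
  rewrite ltnNge; apply/negP => /(jump_pos_homo r); rewrite posk posl.
  by rewrite leqNgt lt_ij.
have := jump_pos_homo r lt_kl; rewrite posl /= -/(jump_pos r k) posk ri.
by rewrite (subnKC (ltnW lt_in)) leqNgt lt_jn.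
Qed.

End Jumps.

Section Tree.
Variable d : nat.

Lemma tree_vertex_take i v : tree_vertex d v -> tree_vertex d (take i v).
Proof.
case: v i => [|c v] [|i] //= /andP[-> /= allv]; apply/allP => x /mem_take.
exact: (allP allv).
Qed.

Fixpoint words (n : nat) : seq (seq nat) :=
  if n is n'.+1 then [seq c :: v | c <- iota 0 d, v <- words n'] else [:: [::]].

Lemma mem_words n v :
  (v \in words n) = (size v == n) && all (fun x => (x < d)%N) v.
Proof.
elim: n v => [|n IH] [|c v] //.
  by apply/negbTE/allpairsP => -[[? ?] []].
apply/allpairsP/idP => [[[c' v'] [/= c'P v'P [-> ->]]]|/=].
  by move: c'P v'P; rewrite mem_iota IH add0n /= eqSS => -> /andP[-> ->].
rewrite eqSS => /andP[sv /andP[lt_cd allv]]; exists (c, v); split=> //=.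
  by rewrite mem_iota.
by rewrite IH sv.
Qed.

Lemma words_uniq n : uniq (words n).
Proof.
elim: n => //= n IH; apply: allpairs_uniq; rewrite ?iota_uniq //.
by move=> [? ?] [? ?] _ _ [-> ->].
Qed.

Lemma size_words n : size (words n) = (d ^ n)%N.
Proof. by elim: n => //= n IH; rewrite size_allpairs size_iota IH expnS. Qed.

Definition level (n : nat) : seq (seq nat) :=
  if n is n'.+1 then [seq c :: v | c <- iota 0 d.+1, v <- words n']
  else [:: [::]].

Lemma mem_level n v : (v \in level n) = (size v == n) && tree_vertex d v.
Proof.
case: n v => [|n] [|c v] //.
  by apply/negbTE/allpairsP => -[[? ?] []].
apply/allpairsP/idP => [[[c' v'] [c'P v'P [-> ->]]]|/=].
  by move: c'P v'P; rewrite mem_iota mem_words add0n /= eqSS => -> /andP[-> ->].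
rewrite eqSS => /andP[sv /andP[lt_cd allv]]; exists (c, v); split=> //=.
  by rewrite (mem_iota 0 d.+1).
by rewrite mem_words sv.
Qed.

Lemma level_uniq n : uniq (level n).
Proof.
case: n => // n; apply: allpairs_uniq; rewrite ?iota_uniq ?words_uniq //.
by move=> [? ?] [? ?] _ _ [-> ->].
Qed.

Lemma size_levelS n : size (level n.+1) = (d.+1 * d ^ n)%N.
Proof. by rewrite size_allpairs size_iota size_words. Qed.

End Tree.

Section Reached.
Variables (d : nat) (Omega : Type) (Rad : seq nat -> Omega -> nat).
Implicit Types (u v : seq nat) (w : Omega).

Lemma cone_reached0 w : cone_reached d Rad w [::].
Proof. by exists 0%N. Qed.

Lemma cone_reached_ball u v w :
  cone_reached d Rad w u -> cone_ball d Rad u w v -> cone_reached d Rad w v.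
Proof. by move=> [n _ un] uv; exists n.+1 => //; exists u. Qed.

Lemma cone_reached_vertex v w : cone_reached d Rad w v -> tree_vertex d v.
Proof. by move=> [[|n] _] => [-> |[u _ []]]. Qed.

(** A ball contains its own centre, so [v] may have been carried over from the previous generation;
    stepping back through such generations leads to a strict ancestor. *)
Lemma cone_reachedP v w : (0 < size v)%N -> cone_reached d Rad w v ->
  exists i, [/\ (i < size v)%N, cone_reached d Rad w (take i v) &
                (size v - i <= Rad (take i v) w)%N].
Proof.
move=> v0 [n _]; elim: n => [/= v_nil|n IH]; first by rewrite v_nil in v0.
move=> [u un [_ [/prefixP[s def_v]]]]; rewrite /tdist => ball.
have [s0|s0] := posnP (size s).
  by apply: IH; rewrite def_v (size0nil s0) cats0.
exists (size u); rewrite def_v take_size_cat // -def_v; split=> //.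
  by rewrite def_v size_cat -[ltnLHS]addn0 ltn_add2l.
by exists n.
Qed.

Lemma cone_reached_take v w i j : tree_vertex d v -> (i <= j <= size v)%N ->
  cone_reached d Rad w (take i v) -> (j - i <= Rad (take i v) w)%N ->
  cone_reached d Rad w (take j v).
Proof.
move=> v_vtx /andP[le_ij le_jv] reach_i ball; apply: cone_reached_ball reach_i _.
split; first exact: tree_vertex_take.
rewrite /tdist !size_takel //; last exact: leq_trans le_jv.
by split=> //; rewrite /below -(take_takel v le_ij) prefix_take.
Qed.

Variable v : seq nat.
Hypothesis v_vtx : tree_vertex d v.

Definition path_radius (i : nat) (w : Omega) : nat := Rad (take i v) w.

Definition reached_at (i : nat) : set Omega :=
  [set w | cone_reached d Rad w (take i v)].

Definition hit_at (i : nat) : set Omega :=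
  [set w | hit (path_radius ^~ w) i].

Lemma reached_atP i w : (0 < i <= size v)%N -> reached_at i w ->
  exists j, [/\ (j < i)%N, reached_at j w & (i - j <= path_radius j w)%N].
Proof.
move=> /andP[i0 le_iv] /cone_reachedP; rewrite size_takel // => /(_ i0)[j []] lt_ji.
by rewrite (take_takel v (ltnW lt_ji)) => reach_j ball; exists j.
Qed.

(** The vertex at depth [i] is covered from a strict ancestor, so only radii at depths below [i]
    matter, by strong induction. *)
Lemma determined_reached_at i : (i <= size v)%N ->
  determined path_radius i (reached_at i).
Proof.
elim/ltn_ind: i => i IH le_iv w w' agree.
have [-> _|i0] := posnP i; first by rewrite /reached_at /= take0; exact: cone_reached0.
move=> /reached_atP; rewrite i0 => /(_ le_iv)[j [lt_ji reach_j ball]].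
apply: (cone_reached_take (i := j)); rewrite ?(ltnW lt_ji) //.
  apply: IH reach_j => //; first by lia.
  by move=> k lt_kj; apply: agree; lia.
by rewrite -/(path_radius j w') -agree.
Qed.

Lemma determined_hit_at i : determined path_radius i (hit_at i).
Proof. by move=> w w' agree; apply: hit_agree. Qed.

Lemma hit_at_reached i : (i <= size v)%N -> hit_at i `<=` reached_at i.
Proof.
elim/ltn_ind: i => i IH le_iv w.
have [-> _|i0] := posnP i; first by rewrite /reached_at /= take0; exact: cone_reached0.
move=> /(hitP i0)[j [lt_ji hit_j rj]].
apply: (cone_reached_take (i := j)); rewrite ?(ltnW lt_ji) //.
  by apply: IH => //; lia.
by rewrite -rj.
Qed.

End Reached.

(** * Expected size of the reached set *)

Definition tail (R : realType) (p : nat -> R) (k : nat) : R :=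
  1 - \sum_(j < k) p j.

(** Cutting the reached set by depth gives disjoint finite pieces, a form in which the expectation
    can be taken term by term. *)
Lemma ecard_levels (R : realType) d (Omega : Type)
    (Rad : seq nat -> Omega -> nat) (w : Omega) :
  ecard (cone_reached d Rad w) =
  (\sum_(n <oo) \sum_(v <- level d n)
      (\1_[set w | cone_reached d Rad w v] w : R)%:E)%E.
Proof.
rewrite /ecard.
have -> : cone_reached d Rad w =
    \bigcup_n (cone_reached d Rad w `&` [set` level d n]).
  apply/seteqP; split=> [v vI|v [n _ []] //]; exists (size v) => //; split=> //=.
  by rewrite mem_level eqxx; exact: cone_reached_vertex vI.
rewrite nneseries_sum_bigcup //; last first.
  move=> i j _ _ [v [[_ /=]]]; rewrite mem_level => /andP[/eqP <- _] [_ /=].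
  by rewrite mem_level => /andP[/eqP <- _].
apply: eq_eseriesr => n _; rewrite esum_mkcondl esum_fset; first last.
- by move=> v _; case: ifP.
- exact: finite_seq.
rewrite [RHS]fsbig_seq ?level_uniq //; apply: eq_fsbigr => v _.
rewrite indicE; case: ifPn => [/set_mem vI|/negP vI]; first by rewrite mem_set.
by rewrite memNset // => /mem_set.
Qed.

Section Percolation.
Variables (R : realType) (dm : measure_display) (Omega : measurableType dm).
Variables (P : probability Omega R) (d : nat) (Rad : seq nat -> Omega -> nat).
Variable p : nat -> R.
Hypothesis Rad_meas : forall v k, measurable [set w | Rad v w = k].
Hypothesis Rad_iid : forall (S : seq (seq nat)) (k : seq nat -> nat),
  uniq S -> all (tree_vertex d) S ->
  P (\bigcap_(v in [set` S]) [set w | Rad v w = k v]) =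
    (\prod_(v <- S) p (k v))%:E.

Lemma path_radius_iid v : tree_vertex d v ->
  forall (S : seq nat) (k : nat -> nat),
  uniq S -> all (fun i => (i <= size v)%N) S ->
  P (\bigcap_(i in [set` S]) [set w | path_radius Rad v i w = k i]) =
    (\prod_(i <- S) p (k i))%:E.
Proof.
move=> v_vtx S k uniqS /allP allS.
have sizeS i : i \in S -> size (take i v) = i by move=> /allS; exact: size_takel.
(* Prefixes of [v] of different lengths are distinct vertices, and [size] recovers the depth from
   the prefix. *)
have := @Rad_iid [seq take i v | i <- S] (k \o size).
rewrite map_inj_in_uniq => [/(_ uniqS)|i j iS jS eq_ij]; last first.
  by rewrite -(sizeS _ iS) eq_ij sizeS.
rewrite big_map (eq_big_seq (fun i => p (k i))); last first.
  by move=> i iS /=; rewrite sizeS.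
move=> <-; last by apply/allP => _ /mapP[i _ ->]; exact: tree_vertex_take.
congr (P _); rewrite !bigcap_seq big_map; apply: eq_big_seq => i iS /=.
by rewrite sizeS.
Qed.

Lemma path_radius_meas v n k : measurable [set w | path_radius Rad v n w = k].
Proof. exact: Rad_meas. Qed.

Lemma reached_at_measurable v i : tree_vertex d v -> (i <= size v)%N ->
  measurable (reached_at d Rad v i).
Proof.
move=> v_vtx le_iv.
exact: (determined_measurable (path_radius_meas v) (determined_reached_at v_vtx le_iv)).
Qed.

Lemma prob_root_radius k : P [set w | Rad [::] w = k] = (p k)%:E.
Proof.
have := @path_radius_iid [::] isT [:: 0%N] (fun=> k) isT isT.
by rewrite bigcap_seq !big_seq1.
Qed.

Lemma p_ge0 k : 0 <= p k.
Proof. by rewrite -lee_fin -prob_root_radius. Qed.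

Lemma tail_ge0 k : 0 <= tail p k.
Proof.
(* With the sure event, independence identifies [tail p k] with the probability that the root radius
   is at least [k]. *)
have := @determined_indep_ge _ _ _ P _ _ _ (path_radius_meas [::])
  (path_radius_iid (v := [::]) isT) 0%N setT k.
rewrite probability_setT mul1e -lee_fin -/(tail p k) => <- //.
Qed.

(** Union bound over the depth [j] of a covering ancestor; several ancestors may cover the same
    vertex, hence an inequality. *)
Lemma prob_reached_le v i : tree_vertex d v -> (i <= size v)%N ->
  (P (reached_at d Rad v i) <= (renewal (tail p) i)%:E)%E.
Proof.
move=> v_vtx; elim/ltn_ind: i => -[_ le_iv|n IH le_nv].
  by rewrite renewal0; apply: probability_le1; exact: reached_at_measurable.
pose F j := reached_at d Rad v j `&`
  [set w | (n.+1 - j <= path_radius Rad v j w)%N].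
have mF j : (j < n.+1)%N -> measurable (F j).
  move=> lt_jn; apply: measurableI.
    by apply: reached_at_measurable => //; lia.
  by apply: measurable_geq_fun => i; exact: path_radius_meas.
have cov : reached_at d Rad v n.+1 `<=` \big[setU/set0]_(j < n.+1) F j.
  move=> w reach; have [//|j [lt_jn reach_j ball]] := reached_atP _ reach.
  by rewrite -bigcup_mkord; exists j.
have mr := reached_at_measurable v_vtx le_nv.
apply: (le_trans (@content_subadditive _ _ _ P _ F n.+1 mF mr cov)).
rewrite renewalS -sumEFin; apply: lee_sum => j _; rewrite EFinM.
have le_jv : (j <= size v)%N by apply: leq_trans (ltnW le_nv); rewrite -ltnS.
rewrite [leLHS](_ : _ = P (reached_at d Rad v j) * (tail p (n.+1 - j))%:E)%E; last first.
  exact: (determined_indep_ge (path_radius_meas v) (path_radius_iid v_vtx)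
    (n.+1 - j) (determined_reached_at v_vtx le_jv) le_jv).
by apply: lee_wpmul2r; [rewrite lee_fin tail_ge0 | apply: IH].
Qed.

(** Here the predecessor is unique, so the events are disjoint and the renewal equation is exact. *)
Lemma prob_hit v i : tree_vertex d v -> (i <= size v)%N ->
  P (hit_at Rad v i) = (renewal p i)%:E.
Proof.
move=> v_vtx; elim/ltn_ind: i => -[_ le_iv|n IH le_nv].
  rewrite renewal0 -(probability_setT P); congr (P _).
  by apply/seteqP; split=> // w _; exact: hit0.
pose F (j : 'I_n.+1) := hit_at Rad v j `&`
  [set w | path_radius Rad v j w = (n.+1 - j)%N].
have mF j : measurable (F j).
  apply: measurableI; last exact: path_radius_meas.
  exact: (determined_measurable (path_radius_meas v) (@determined_hit_at _ Rad v j)).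
have tF : trivIset setT F.
  move=> i j _ _ [w [[/= hi ri] [/= hj rj]]]; apply: val_inj.
  exact: (hit_pred_uniq (ltn_ord i) (ltn_ord j) hi ri hj rj).
have -> : hit_at Rad v n.+1 = \big[setU/set0]_(j < n.+1) F j.
  rewrite -bigcup_seq; apply/seteqP; split=> [w /hitP[//|j [lt_jn hj rj]]|w].
    by exists (Ordinal lt_jn); rewrite //= mem_index_enum.
  move=> [j _ [/= hj rj]]; rewrite /hit_at /= -(subnKC (ltnW (ltn_ord j))) -rj.
  exact: hit_jump.
apply: (etrans (measure_bigsetU_ord P xpredT mF tF)).
rewrite renewalS -sumEFin; apply: eq_bigr => j _; rewrite EFinM.
have le_jv : (j <= size v)%N by apply: leq_trans (ltnW le_nv); rewrite -ltnS.
rewrite -IH //.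
exact: (determined_indep (path_radius_meas v) (path_radius_iid v_vtx)
  (n.+1 - j) (@determined_hit_at _ Rad v j) le_jv).
Qed.

Lemma prob_reached v : tree_vertex d v ->
  measurable [set w | cone_reached d Rad w v] /\
  ((renewal p (size v))%:E <= P [set w | cone_reached d Rad w v]
     <= (renewal (tail p) (size v))%:E)%E.
Proof.
move=> v_vtx.
have -> : [set w | cone_reached d Rad w v] = reached_at d Rad v (size v).
  by rewrite /reached_at take_size.
have mr := reached_at_measurable v_vtx (leqnn _).
split=> //; rewrite prob_reached_le // andbT -(prob_hit v_vtx) //.
apply: le_measure; rewrite ?inE //; last exact: hit_at_reached.
exact: (determined_measurable (path_radius_meas v) (@determined_hit_at _ Rad v _)).
Qed.

Lemma integral_ecard :
  (\int[P]_w ecard (cone_reached d Rad w) =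
   \sum_(n <oo) \sum_(v <- level d n) P [set w | cone_reached d Rad w v])%E.
Proof.
pose I v := [set w | cone_reached d Rad w v].
have mI v : measurable (I v).
  have [v_vtx|nv] := boolP (tree_vertex d v); first by case: (prob_reached v_vtx).
  suff -> : I v = set0 by exact: measurable0.
  by apply/seteqP; split=> // w vI; case/negP: nv; exact: cone_reached_vertex vI.
have mind v : measurable_fun setT (EFin \o (\1_(I v) : Omega -> R)).
  by apply/measurable_EFinP; exact: measurable_indic.
under eq_integral do rewrite ecard_levels.
rewrite integral_nneseries //; last 2 first.
- by move=> n; apply: emeasurable_sum.
- by move=> n w _; apply: sume_ge0 => v _; rewrite lee_fin.
apply: eq_eseriesr => n _; rewrite ge0_integral_sum //.
by apply: eq_bigr => v _; rewrite integral_indic ?setIT //; exact: mI.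
Qed.

Lemma expectation_root_radius (f : nat -> R) : (forall k, 0 <= f k) ->
  (\int[P]_w (f (Rad [::] w))%:E = \sum_(k <oo) (f k * p k)%:E)%E.
Proof.
move=> f0.
have fE w : (f (Rad [::] w))%:E =
    (\sum_(k <oo) (f k)%:E * (\1_[set w | Rad [::] w = k] w)%:E)%E.
  rewrite nneseries_esumT; last by move=> k; rewrite -EFinM lee_fin mulr_ge0.
  rewrite -[LHS](@esum_set1 _ _ (Rad [::] w) (fun k => (f k)%:E)) ?lee_fin //.
  rewrite esum_mkcond; apply: eq_esum => k _; rewrite indicE.
  case: ifPn => [/set_mem -> |/negP kw]; first by rewrite mem_set ?mule1.
  by rewrite memNset ?mule0 // => wk; apply/kw/mem_set.
under eq_integral do rewrite fE.
have mind k : measurable_fun setT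
    (EFin \o (\1_[set w | Rad [::] w = k] : Omega -> R)).
  by apply/measurable_EFinP; exact: measurable_indic.
rewrite integral_nneseries //; last 2 first.
  by move=> k; apply: measurable_funeM; exact: mind.
  by move=> k w _; rewrite -EFinM lee_fin mulr_ge0.
apply: eq_eseriesr => k _.
rewrite ge0_integralZl_EFin //; last exact: mind.
rewrite integral_indic // setIT EFinM.
by congr (_ * _)%E; exact: prob_root_radius.
Qed.

(** The total mass of [p] is 1, as the expectation of the constant function 1 of the root radius. *)
Lemma tail_series N : (\sum_(N <= k <oo) (p k)%:E = (tail p N)%:E)%E.
Proof.
have := @expectation_root_radius (fun=> 1) (fun=> ler01).
rewrite integral_cst // mul1e => /(etrans (esym (probability_setT P))).
under eq_eseriesr do rewrite mul1r.
rewrite (@nneseries_split _ _ 0 N) ?add0n //; last first.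
  by move=> k _; rewrite lee_fin p_ge0.
rewrite sumEFin big_mkord => eq1; rewrite /tail EFinB eq1.
by rewrite addeAC subee // add0e.
Qed.

(** Summation by parts. The parenthesis on the right is the moment of the truncated radius,
    [E(d^min(R,N)) - 1]. *)
Lemma sum_pow_tail N : (d%:R - 1) * \sum_(k < N) d%:R ^+ k.+1 * tail p k.+1 =
  d%:R * (\sum_(j < N) d%:R ^+ j * p j + d%:R ^+ N * tail p N - 1).
Proof.
elim: N => [|N IH]; first by rewrite /tail !big_ord0 expr0; ring.
rewrite !big_ord_recr /= mulrDr IH /tail big_ord_recr /= exprS; ring.
Qed.

(** Monotonicity of [d ^ k] in [k]: truncating the radius at [N] can only lower the moment. *)
Lemma truncated_moment_le N m : (1 <= d)%N ->
  (\int[P]_w ((d%:R : R) ^+ Rad [::] w)%:E)%E = m%:E ->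
  \sum_(j < N) d%:R ^+ j * p j + d%:R ^+ N * tail p N <= m.
Proof.
move=> d1; rewrite (@expectation_root_radius (fun k => d%:R ^+ k)); last first.
  by move=> k; rewrite exprn_ge0.
rewrite (@nneseries_split _ _ 0 N) ?add0n; last first.
  by move=> k _; rewrite lee_fin mulr_ge0 ?exprn_ge0 ?p_ge0.
rewrite sumEFin big_mkord => eqm; rewrite -lee_fin -eqm EFinD leeD2lE //.
rewrite EFinM -tail_series -nneseriesZl; last first.
  by move=> k _; rewrite lee_fin p_ge0.
rewrite [leLHS]eseries_cond [leRHS]eseries_cond.
apply: lee_nneseries.
  by move=> k _ _; rewrite -EFinM lee_fin mulr_ge0 ?exprn_ge0 ?p_ge0.
move=> k; move=> /andP[_ le_Nk].
have D1 : 1 <= d%:R :> R by rewrite ler1n.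
by rewrite -EFinM lee_fin; apply: ler_wpM2r; [exact: p_ge0 | exact: ler_weXn2l].
Qed.

End Percolation.

(** Level [n >= 1] has [(d + 1) / d * d ^ n] vertices; the root does not fit this formula and is
    split off, whence the [1 +] and the [- 1]. *)
Lemma sum_level_renewal (R : realType) d (g : nat -> R) N : (1 <= d)%N ->
  \sum_(n < N.+1) (size (level d n))%:R * renewal g n =
  1 + (d%:R + 1) / d%:R *
      (\sum_(n < N.+1) renewal (fun k => d%:R ^+ k * g k) n - 1).
Proof.
move=> d1; have d0 : d%:R != 0 :> R by rewrite pnatr_eq0 -lt0n.
rewrite !big_ord_recl !renewal0 mulr1 addrAC subrr add0r mulr_sumr.
congr (_ + _); apply: eq_bigr => i _; rewrite lift0.
rewrite renewal_scale size_levelS natrM natrX -natr1 exprS; by field.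
Qed.

(** * The upper and lower bounds on the expected size *)

Section Bounds.
Variables (R : realType) (dm : measure_display) (Omega : measurableType dm).
Variables (P : probability Omega R) (d : nat) (Rad : seq nat -> Omega -> nat).
Variable p : nat -> R.
Hypothesis d_gt0 : (1 <= d)%N.
Hypothesis Rad_meas : forall v k, measurable [set w | Rad v w = k].
Hypothesis Rad_iid : forall (S : seq (seq nat)) (k : seq nat -> nat),
  uniq S -> all (tree_vertex d) S ->
  P (\bigcap_(v in [set` S]) [set w | Rad v w = k v]) =
    (\prod_(v <- S) p (k v))%:E.

Lemma prob_level_bounds n :
  (((size (level d n))%:R * renewal p n)%:E
     <= \sum_(v <- level d n) P [set w | cone_reached d Rad w v]
     <= ((size (level d n))%:R * renewal (tail p) n)%:E)%E.
Proof.
have cstE (a : R) : (((size (level d n))%:R * a)%:E = \sum_(v <- level d n) a%:E)%E.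
  by rewrite sumEFin big_const_seq count_predT iter_addr_0 mulr_natl.
by rewrite !cstE; apply/andP; split; rewrite [leLHS]big_seq [leRHS]big_seq;
  apply: lee_sum => v; rewrite mem_level => /andP[/eqP <- v_vtx];
  have [_ /andP[]] := prob_reached Rad_meas Rad_iid v_vtx.
Qed.

Lemma integral_ecard_le m : (2 <= d)%N ->
  (\int[P]_w ((d%:R : R) ^+ Rad [::] w)%:E)%E = m%:E ->
  m < 2 - d%:R^-1 ->
  (\int[P]_w ecard (cone_reached d Rad w)
     <= ((m + d%:R - 2) / (2 * d%:R - 1 - d%:R * m))%:E)%E.
Proof.
move=> d2 mE m_lt; have D2 : 2 <= d%:R :> R by rewrite ler_nat.
have dm_lt : d%:R * m < 2 * d%:R - 1.
  have dV : d%:R * d%:R^-1 = 1 :> R by rewrite divff // gt_eqF //; lra.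
  by nra.
(* By [sum_pow_tail], [q] bounds the sums of the weights [d ^ k * P(R >= k)] over [k >= 1]; for
   [d >= 2], [q < 1] is exactly [m < 2 - 1/d]. *)
pose q := d%:R * (m - 1) / (d%:R - 1) : R.
have q1 : q < 1 by rewrite /q ltr_pdivrMr; lra.
have g0 k : 0 <= d%:R ^+ k * tail p k :> R.
  by rewrite mulr_ge0 ?exprn_ge0 ?(tail_ge0 Rad_meas Rad_iid).
have leq N : \sum_(k < N) d%:R ^+ k.+1 * tail p k.+1 <= q.
  rewrite /q ler_pdivlMr ?subr_gt0; last by lra.
  rewrite mulrC sum_pow_tail ler_wpM2l // lerD2r.
  exact: (truncated_moment_le Rad_meas Rad_iid).
rewrite (integral_ecard Rad_meas Rad_iid).
set U := fun n => (\sum_(v <- level d n) P [set w | cone_reached d Rad w v])%E.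
have U0 n : (0 <= U n)%E by apply: sume_ge0.
apply: lime_le; first by apply: is_cvg_nneseries => n _ _; exact: U0.
apply: nearW => N.
apply: (@le_trans _ _ (\sum_(0 <= n < N.+1) U n)%E).
  by rewrite big_nat_recr //= leeDl.
apply: (@le_trans _ _
    (\sum_(n < N.+1) (size (level d n))%:R * renewal (tail p) n)%:E).
  rewrite -sumEFin big_mkord; apply: lee_sum => n _.
  by have /andP[] := prob_level_bounds n.
rewrite lee_fin sum_level_renewal //.
have := renewal_sum_bounded g0 (leq N) q1; set X := \sum_(n < _) _ => X_le.
have -> : (m + d%:R - 2) / (2 * d%:R - 1 - d%:R * m) =
    1 + (d%:R + 1) / d%:R * ((1 - q)^-1 - 1).
  by rewrite /q; field; rewrite !gt_eqF //; lra.
rewrite lerD2l ler_wpM2l ?lerD2r // divr_ge0; lra.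
Qed.

Lemma integral_ecard_ge m :
  (\int[P]_w ((d%:R : R) ^+ Rad [::] w)%:E)%E = m%:E ->
  (((d%:R + m - p 0%N) / (d%:R * (1 - m + p 0%N)))%:E
     <= \int[P]_w ecard (cone_reached d Rad w))%E.
Proof.
move=> mE; have D1 : 1 <= d%:R :> R by rewrite ler1n.
rewrite (integral_ecard Rad_meas Rad_iid).
set U := fun n => (\sum_(v <- level d n) P [set w | cone_reached d Rad w v])%E.
have U0 n : (0 <= U n)%E by apply: sume_ge0.
have p0 := p_ge0 Rad_iid.
have g0 k : 0 <= d%:R ^+ k * p k :> R by rewrite mulr_ge0 ?exprn_ge0.
have : (0 <= \sum_(n <oo) U n)%E by apply: nneseries_ge0.
(* If the expected size is infinite the bound is trivial, so let it be a real number [e]. *)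
case EU : (\sum_(n <oo) U n)%E => [e| |] // _; last by rewrite leey.
(* [c] solves [1 + (d + 1) / d * (c - 1) = e], so it bounds the partial sums [Y]. *)
pose c := 1 + (e - 1) * d%:R / (d%:R + 1).
pose Y N := \sum_(n < N) renewal (fun k => d%:R ^+ k * p k) n.
have Ye N : 1 + (d%:R + 1) / d%:R * (Y N.+1 - 1) <= e.
  rewrite -sum_level_renewal // -lee_fin -EU -sumEFin.
  apply: (@le_trans _ _ (\sum_(0 <= n < N.+1) U n)%E).
    rewrite big_mkord; apply: lee_sum => n _.
    by have /andP[] := prob_level_bounds n.
  exact: nneseries_lim_ge.
have Yc N : Y N <= c.
  apply: (@le_trans _ _ (Y N.+1)).
    by rewrite /Y big_ord_recr /= lerDl renewal_ge0.
  rewrite /c -lerBlDl ler_pdivlMr; last by lra.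
  rewrite -ler_pdivrMr; last by lra.
  by have := Ye N; lra.
have Mc K := renewal_sum_bound_ge g0 K Yc.
have c1 : 1 <= c by have := Mc 0%N; rewrite big_ord0; lra.
(* [Mc] bounds the sum of [d ^ k * p k] over [1 <= k <= K] by [1 - 1/c]; let [K] grow and add the
   term [p 0]. This also makes the denominator [1 - m + p 0] positive. *)
have m_le : m <= p 0%N + 1 - c^-1.
  rewrite -lee_fin -mE (expectation_root_radius Rad_meas Rad_iid); last first.
    by move=> k; rewrite exprn_ge0.
  apply: lime_le; first by apply: is_cvg_nneseries => k _ _; rewrite lee_fin.
  apply: nearW => K; rewrite sumEFin lee_fin.
  apply: (@le_trans _ _ (\sum_(0 <= k < K.+1) d%:R ^+ k * p k)).
    by rewrite big_nat_recr //= lerDl.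
  rewrite big_mkord big_ord_recl expr0 mul1r -addrA lerD2l.
  have := Mc K; rewrite -ler_pdivrMl; last by lra.
  by rewrite mulr1 /=; lra.
have ci : 0 < c^-1 by rewrite invr_gt0; lra.
have cm : 1 <= c * (1 - m + p 0%N).
  by rewrite -ler_pdivrMl ?mulr1; lra.
have eE : e = 1 + (c - 1) * (d%:R + 1) / d%:R.
  by rewrite /c; field; rewrite !gt_eqF //; lra.
rewrite lee_fin ler_pdivrMr; last by apply: mulr_gt0; lra.
rewrite eE.
have -> : (1 + (c - 1) * (d%:R + 1) / d%:R) * (d%:R * (1 - m + p 0%N)) =
  (d%:R + 1) * (c * (1 - m + p 0%N)) - (1 - m + p 0%N).
  by field; rewrite gt_eqF //; lra.
have : (d%:R + 1) * 1 <= (d%:R + 1) * (c * (1 - m + p 0%N)).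
  by apply: ler_wpM2l => //; lra.
lra.
Qed.

End Bounds.

Theorem theorem1 (R : realType) (dm : measure_display) (Omega : measurableType dm)
  (P : probability Omega R) (d : nat) (Rad : seq nat -> Omega -> nat)
  (p : nat -> R) :
  (1 <= d)%N ->
  (* each {R_v = k} is an event *)
  (forall v k, measurable [set w | Rad v w = k]) ->
  (* {R_v}_v are i.i.d. with P(R = k) = p_k (product rule on every finite
     family of distinct vertices) *)
  (forall (S : seq (seq nat)) (k : seq nat -> nat),
      uniq S -> all (tree_vertex d) S ->
      P (\bigcap_(v in [set` S]) [set w | Rad v w = k v]) =
        ((\prod_(v <- S) p (k v))%:E)) ->
  0 < p 0%N < 1 ->
  let EdR := (\int[P]_w (((d%:R : R) ^+ Rad [::] w)%:E))%E in
  let m := fine EdR in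
  (EdR < (2 - (d%:R)^-1)%:E)%E ->
  (((d%:R + m - p 0%N) / (d%:R * (1 - m + p 0%N)))%:E
     <= \int[P]_w (ecard (cone_reached d Rad w)))%E /\
  (\int[P]_w (ecard (cone_reached d Rad w))
     <= ((m + d%:R - 2) / (2 * d%:R - 1 - d%:R * m))%:E)%E.
Proof.
move=> d1 Rad_meas Rad_iid _ EdR m EdR_lt.
(* [fine] sends infinite values to 0, so finiteness must be known before [m] can stand for the
   moment. *)
have EdR_fin : EdR \is a fin_num.
  rewrite ge0_fin_numE ?(lt_trans EdR_lt) ?ltry //.
  by apply: integral_ge0 => w _; rewrite lee_fin exprn_ge0.
have mE : EdR = m%:E by rewrite fineK.
have m_lt : m < 2 - d%:R^-1 by rewrite -lte_fin -mE.
split; first exact: (integral_ecard_ge d1 Rad_meas Rad_iid mE).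
apply: (integral_ecard_le _ Rad_meas Rad_iid _ mE m_lt); rewrite //.
(* For d = 1 the moment E(1^R) = 1 violates the hypothesis. *)
rewrite ltn_neqAle d1 andbT; apply/eqP => d_eq1; move: m_lt.
have -> : m = 1.
  apply: EFin_inj; rewrite -mE /EdR -d_eq1.
  under eq_integral do rewrite expr1n.
  by rewrite integral_cst // mul1e; exact: probability_setT.
by rewrite -d_eq1 invr1; lra.
Qed.
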